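(* Let $G(\pi) = (X,Y,E_{XY},\pi_{XY})$ be a colored bipartite graph with $|X| = |Y|$. Then all matrices in the pattern class $\mathcal{P}_{\pi}(G)$ are nonsingular if and only if there exists at least one perfect matching of $G(\pi)$ and exactly one equivalence class of perfect matchings has nonzero signature.
   Context: A bipartite graph $G=(X,Y,E_{XY})$ is an undirected graph with vertex set the disjoint union of nonempty sets $X=\{x_1,\dots,x_s\}$ and $Y=\{y_1,\dots,y_t\}$, whose edges are all of the form $\{x_i,y_j\}$. A colored bipartite graph $G(\pi)=(X,Y,E_{XY},\pi_{XY})$ is such a graph together with a partition $\pi_{XY}=\{E_{XY}^1,\dots,E_{XY}^\ell\}$ of the edge set $E_{XY}$; the edges in cell $E_{XY}^r$ are said to have color $c_r$. Its pattern class is the set $\mathcal{P}_\pi(G)$ of complex matrices $M\in\mathbb{C}^{t\times s}$ such that (i) $M_{ji}\neq 0$ if and only if $\{x_i,y_j\}\in E_{XY}$, and (ii) $M_{ji}=M_{hg}$ whenever $\{x_i,y_j\}$ and $\{x_g,y_h\}$ belong to the same cell $E_{XY}^r$ for some $r$. Assume $|X|=|Y|=t$. A perfect matching is a set of $t$ edges no two distinct of which share a vertex; it has the form $p=\{\{x_1,y_{\gamma(1)}\},\dots,\{x_t,y_{\gamma(t)}\}\}$ for a permutation $\gamma$ of $(1,\dots,t)$. Its sign is $\operatorname{sign}(p)=(-1)^m$, where $m$ is the number of swaps needed to obtain $(\gamma(1),\dots,\gamma(t))$ from $(1,\dots,t)$ (the sign of $\gamma$). Its spectrum is the multiset of colors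 of its edges (counting multiplicity). Two perfect matchings are equivalent if they have the same spectrum; this partitions the set of perfect matchings into equivalence classes $\mathbb{P}_1,\dots,\mathbb{P}_l$. The signature of a class is $\operatorname{sgn}(\mathbb{P}_i)=\sum_{p\in\mathbb{P}_i}\operatorname{sign}(p)$. *)

(* Defs.v *)
From mathcomp Require Import all_boot all_order all_algebra all_fingroup.
From mathcomp Require Import finmap multiset complex reals.

Set Implicit Arguments.
Unset Strict Implicit.
Unset Printing Implicit Defensive.

Import Order.TTheory GRing.Theory Num.Theory.
Local Open Scope mset_scope.
Local Open Scope ring_scope.

(* A colored bipartite graph with X = {x_i | i : 'I_s} and Y = {y_j | j : 'I_t}.
   The pair (i, j) stands for the undirected edge {x_i, y_j}, so X and Y are
   disjoint by construction. A color is identified with its cell. *)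
Record colored_bigraph (s t : nat) := ColoredBigraph {
  edges : {set 'I_s * 'I_t};
  cells : {set {set 'I_s * 'I_t}};
  X_nonempty : (0 < s)%N;
  Y_nonempty : (0 < t)%N;
  cells_partition : partition cells edges
}.

Definition edge_color s t (G : colored_bigraph s t) (e : 'I_s * 'I_t) :
  {set 'I_s * 'I_t} := pblock (cells G) e.

(* Rows are indexed by Y and columns by X. *)
Definition pattern_class (R : realType) s t (G : colored_bigraph s t)
    (M : 'M[R[i]]_(t, s)) : Prop :=
  (forall i j, M j i != 0 <-> (i, j) \in edges G) /\
  (forall c, c \in cells G -> forall i j g h,
     (i, j) \in c -> (g, h) \in c -> M j i = M h g).

Section Matchings.
Variables (t : nat) (G : colored_bigraph t t).
Implicit Types (p : {set 'I_t * 'I_t}) (gamma : 'S_t).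

Definition perfect_matching p : bool :=
  [&& p \subset edges G, #|p| == t &
      [forall e in p, forall f in p, (e != f) ==> (e.1 != f.1) && (e.2 != f.2)]].

Definition perm_matching gamma : {set 'I_t * 'I_t} :=
  [set (i, gamma i) | i : 'I_t].

(* The default value 0 is never used on perfect matchings: see
   [perfect_matching_perm] and [matching_sign_perm] below. *)
Definition matching_sign p : int :=
  if [pick gamma | p == perm_matching gamma] is Some gamma
  then (-1) ^+ gamma else 0.

Definition spectrum p : {mset {set 'I_t * 'I_t}} :=
  seq_mset [seq edge_color G e | e <- enum p].

Definition matching_classes : {set {set {set 'I_t * 'I_t}}} :=
  preim_partition spectrum [set p | perfect_matching p].

Definition signature (P : {set {set 'I_t * 'I_t}}) : int :=
  \sum_(p in P) matching_sign p.

Lemma perm_matching_inj : injective perm_matching.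
Proof.
move=> g h gh; apply/permP => i.
have : (i, g i) \in perm_matching h by rewrite -gh; apply/imsetP; exists i.
by case/imsetP => j _ [-> ->].
Qed.

Lemma matching_sign_perm gamma :
  matching_sign (perm_matching gamma) = (-1) ^+ gamma.
Proof.
rewrite /matching_sign; case: pickP => [h /eqP/perm_matching_inj -> //|].
by move/(_ gamma); rewrite eqxx.
Qed.

Lemma perfect_matching_perm p :
  perfect_matching p -> exists gamma, p = perm_matching gamma.
Proof.
case/and3P => _ /eqP cp /forall_inP dis.
have inj1 : {in p &, injective (fun e : 'I_t * 'I_t => e.1)}.
  move=> e f ep fp e1; apply/eqP; apply: contraT => ne.
  by move/forall_inP: (dis e ep) => /(_ f fp); rewrite ne e1 eqxx.
have inj2 : {in p &, injective (fun e : 'I_t * 'I_t => e.2)}.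
  move=> e f ep fp e2; apply/eqP; apply: contraT => ne.
  by move/forall_inP: (dis e ep) => /(_ f fp); rewrite ne e2 eqxx andbF.
have im1 : [set e.1 | e in p] = [set: 'I_t].
  by apply/eqP; rewrite eqEcard subsetT cardsT card_ord card_in_imset ?cp /=.
have ex i : exists j, (i, j) \in p.
  have : i \in [set e.1 | e in p] by rewrite im1 inE.
  by case/imsetP => [[a b] ab ->]; exists b.
pose f i := xchoose (ex i).
have fP i : (i, f i) \in p by exact: xchooseP (ex i).
have finj : injective f.
  by move=> i j fij; have [] := inj2 _ _ (fP i) (fP j) fij.
exists (perm finj); apply/setP => -[i j]; apply/idP/imsetP.
  move=> ijp; exists i => //; rewrite permE.
  exact: inj1 ijp (fP i) erefl.
by case=> k _ [-> ->]; rewrite permE.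
Qed.

Lemma perfect_matching_permE gamma :
  perfect_matching (perm_matching gamma)
  = [forall i, (i, gamma i) \in edges G].
Proof.
apply/and3P/forallP => [[/subsetP sub _ _] i | all_e].
  by apply: sub; apply/imsetP; exists i.
split.
- by apply/subsetP => _ /imsetP[i _ ->].
- by rewrite card_imset ?card_ord // => i j [].
- apply/forall_inP => _ /imsetP[i _ ->].
  apply/forall_inP => _ /imsetP[j _ ->]; apply/implyP => /=.
  by rewrite (inj_eq perm_inj) andbb; apply: contra => /eqP ->.
Qed.

End Matchings.

(* Main.v *)
Require Import Defs.
From mathcomp Require Import all_boot all_order all_algebra all_fingroup.
From mathcomp Require Import finmap multiset complex reals.
Import GRing.Theory Num.Theory.
Local Open Scope ring_scope.

(** Give each color c an indeterminate x_c. The Leibniz formula expands the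
determinant of the generic matrix with the pattern of G into one signed
monomial per perfect matching, and two matchings have the same monomial exactly
when they have the same spectrum. Collecting equal monomials, the determinant
is the sum over the classes P of sgn(P) times the monomial of P, and these
monomials are distinct ([det_color_matrix]). The matrices of the pattern class
are the values of the generic matrix at points with nonzero coordinates
([pattern_classP]). So the theorem says that a complex polynomial has no zero
with all coordinates nonzero iff exactly one of its coefficients is nonzero.

A single nonzero term clearly vanishes nowhere on such points, and if all
coefficients vanish, the all-ones point gives a singular matrix. The remaining
case is that of two classes of nonzero signature ([two_classes_singular]). It is
reduced to one variable by the Kronecker substitution x_c := X ^ (t+1)^(rank of
c). A color occurs at most t times in a matching, so the exponent of X in the
resulting monomial is a number whose digits in base t+1 are the multiplicities
of the colors: distinct spectra keep distinct exponents
([kronecker_monomial_inj]). The determinant becomes a univariate polynomial with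
two nonzero coefficients, hence with a nonzero root z ([closed_nonzero_root]),
and the point x_c = z ^ (t+1)^(rank of c) gives a singular matrix. *)

(** * Kronecker substitution *)

Lemma digits_inj (B n : nat) (f g : 'I_n -> nat) :
  (forall i, f i < B)%N -> (forall i, g i < B)%N ->
  (\sum_(i < n) f i * B ^ i = \sum_(i < n) g i * B ^ i)%N -> f =1 g.
Proof.
elim: n f g => [|n IHn] f g ltf ltg; first by move=> _ [].
have low_digit (h : 'I_n.+1 -> nat) :
  (\sum_(i < n.+1) h i * B ^ i
   = (\sum_(i < n) h (lift ord0 i) * B ^ i) * B + h ord0)%N.
  rewrite big_ord_recl expn0 muln1 addnC big_distrl /=; congr addn.
  by apply: eq_bigr => i _; rewrite expnS mulnA mulnAC.
rewrite !low_digit => eq_fg.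
have B_gt0 : (0 < B)%N by apply: leq_ltn_trans (ltf ord0).
have eq0 : f ord0 = g ord0.
  by have /(congr1 (modn^~ B)) := eq_fg; rewrite !modnMDl !modn_small.
have eqS : (fun i => f (lift ord0 i)) =1 (fun i => g (lift ord0 i)).
  apply: IHn => //; apply/eqP; rewrite -(eqn_pmul2r B_gt0).
  by rewrite -(eqn_add2r (f ord0)) {2}eq0 eq_fg.
by move=> i; case: (unliftP ord0 i) => [j|] ->.
Qed.

(** The exponent given to the color [c] when multiplicities are at most [n]. *)
Definition kronecker_weight {C : finType} (n : nat) (c : C) : nat :=
  n.+1 ^ enum_rank c.

(** In base [n.+1], the digits of the weight of [s] are the multiplicities of its
entries, so the weight recovers [s] as a multiset. *)
Lemma kronecker_weight_inj {C : finType} (n : nat) (s1 s2 : seq C) :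
  (size s1 <= n)%N -> (size s2 <= n)%N ->
  (\sum_(c <- s1) kronecker_weight n c = \sum_(c <- s2) kronecker_weight n c)%N ->
  perm_eq s1 s2.
Proof.
move=> le1 le2.
have weightE (s : seq C) : (\sum_(c <- s) kronecker_weight n c
    = \sum_(i < #|C|) count_mem (enum_val i) s * n.+1 ^ i)%N.
  transitivity (\sum_(c : C) count_mem c s * kronecker_weight n c)%N.
    rewrite (partition_big id predT) //=; apply: eq_bigr => c _.
    rewrite (eq_bigr (fun=> kronecker_weight n c)) => [|d /eqP <- //].
    by rewrite big_const_seq iter_addn_0 mulnC.
  rewrite (reindex (@enum_val C predT)) /=; last exact: onW_bij (enum_val_bij C).
  by apply: eq_bigr => i _; rewrite /kronecker_weight enum_valK.
rewrite !weightE => eq12.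
have count_lt (s : seq C) c : (size s <= n)%N -> (count_mem c s < n.+1)%N.
  by move=> les; rewrite ltnS (leq_trans (count_size _ _)).
have eq_count : (fun i : 'I_#|C| => count_mem (enum_val i) s1)
             =1 (fun i : 'I_#|C| => count_mem (enum_val i) s2).
  by apply: digits_inj eq12 => i; apply: count_lt.
apply/allP => c _ /=.
by have /eqP := eq_count (enum_rank c); rewrite enum_rankK.
Qed.

(** Factor [p] as [q * 'X^m] with [q] not vanishing at 0. As [p] is not a
monomial, [q] is not constant and has a root, which cannot be 0. *)
Lemma closed_nonzero_root {F : closedFieldType} (p : {poly F}) (i j : nat) :
  i != j -> p`_i != 0 -> p`_j != 0 -> exists2 z : F, z != 0 & root p z.
Proof.
move=> neq_ij pi_neq0 pj_neq0.
have [m [q q0 pE]] := multiplicity_XsubC p 0.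
have p_neq0 : p != 0 by apply: contraNneq pi_neq0 => ->; rewrite coef0.
rewrite p_neq0 /= in q0; rewrite subr0 in pE.
have size_q : size q != 1.
  apply/negP => /size_poly1P[c c_neq0 qE].
  have only_m k : p`_k != 0 -> k = m.
    rewrite pE qE coefCM coefXn; case: (k =P m) => // _.
    by rewrite mulr0 eqxx.
  by rewrite (only_m i pi_neq0) (only_m j pj_neq0) eqxx in neq_ij.
have [z qz] := closed_rootP q size_q.
exists z; first by apply: contraNneq q0 => <-.
by rewrite pE rootM qz.
Qed.

(** * Matrices of the pattern class *)

(** The ring [A] is arbitrary because the matrix is used both with complex
entries and with entries in [{poly R[i]}]. *)
Definition color_matrix {A : comNzRingType} {t} (G : colored_bigraph t t)
    (v : {set 'I_t * 'I_t} -> A) : 'M[A]_t :=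
  \matrix_(j, i) if (i, j) \in edges G then v (edge_color G (i, j)) else 0.

(** A matrix of the pattern class is constant on each cell, so it is determined
by a value per color, read off at any edge of the cell. *)
Lemma pattern_classP (R : realType) t (G : colored_bigraph t t)
    (M : 'M[R[i]]_t) :
  pattern_class G M <-> exists2 v, (forall c, v c != 0) & M = color_matrix G v.
Proof.
have /and3P[/eqP cover_cells triv_cells set0_cells] := cells_partition G.
have color_cell e : e \in edges G -> edge_color G e \in cells G.
  by rewrite -cover_cells => /pblock_mem.
have mem_color e : e \in edges G -> e \in edge_color G e.
  by rewrite -cover_cells mem_pblock.
have cell_edge c e : c \in cells G -> e \in c -> e \in edges G.
  by move=> cG ec; rewrite -cover_cells; apply/bigcupP; exists c.
split=> [[Mnz Mcell] | [v v_neq0 ->]].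
  (* The value 1 on sets that are not cells makes [v] nonzero everywhere. *)
  exists (fun c : {set _} => if [pick e in c | c \in cells G] is Some e
                   then M e.2 e.1 else 1) => [c|].
    case: pickP => [[i j] /= /andP[ec cG] | _]; last exact: oner_neq0.
    by apply/Mnz/(cell_edge c).
  apply/matrixP => j i; rewrite mxE; case: ifP => [eG | /negP eNG].
    case: pickP => [[g h] /= /andP[gh cG] | /(_ (i, j))].
      exact: (Mcell _ cG) (mem_color _ eG) gh.
    by rewrite mem_color ?color_cell.
  by apply/eqP; apply: contra_notT eNG => /Mnz.
split=> [i j | c cG i j g h ijc ghc].
  by rewrite mxE; case: ifP => _; rewrite ?v_neq0 ?eqxx.
rewrite !mxE !(cell_edge c) // /edge_color.
by rewrite (def_pblock triv_cells cG ijc) (def_pblock triv_cells cG ghc).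
Qed.

(** * The determinant as a sum over classes of matchings *)

Definition matching_monomial {A : comNzRingType} {t} (G : colored_bigraph t t)
    (v : {set 'I_t * 'I_t} -> A) (p : {set 'I_t * 'I_t}) : A :=
  \prod_(e in p) v (edge_color G e).

Definition class_rep {t} (P : {set {set 'I_t * 'I_t}}) : {set 'I_t * 'I_t} :=
  odflt set0 [pick p in P].

Lemma matching_classes_partition t (G : colored_bigraph t t) :
  partition (matching_classes G) [set p | perfect_matching G p].
Proof. exact: preim_partitionP. Qed.

Lemma class_rep_mem t (G : colored_bigraph t t) P :
  P \in matching_classes G -> class_rep P \in P.
Proof.
have /and3P[_ _ set0NP] := matching_classes_partition t G.
rewrite /class_rep => PG; case: pickP => //= P0.
have P_eq0 : P = set0 by apply/setP => p; rewrite P0 inE.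
by rewrite -P_eq0 PG in set0NP.
Qed.

Lemma class_matching t (G : colored_bigraph t t) P p :
  P \in matching_classes G -> p \in P -> perfect_matching G p.
Proof.
move=> PG pP; have /and3P[/eqP coverG _ _] := matching_classes_partition t G.
have : p \in cover (matching_classes G) by apply/bigcupP; exists P.
by rewrite coverG inE.
Qed.

Lemma class_spectrum t (G : colored_bigraph t t) P Q p q :
  P \in matching_classes G -> Q \in matching_classes G ->
  p \in P -> q \in Q -> (P == Q) = (spectrum G p == spectrum G q).
Proof.
move=> PG QG pP qQ.
have /and3P[_ trivG _] := matching_classes_partition t G.
rewrite -(def_pblock trivG PG pP) -(def_pblock trivG QG qQ) eq_pblock //.
  2: by apply/bigcupP; exists P.
rewrite pblock_equivalence_partition ?inE.
- by [].
- by move=> x y z _ _ _; split=> // /eqP ->.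
- exact: class_matching pP.
- exact: class_matching qQ.
Qed.

Lemma monomial_spectrum (A : comNzRingType) t (G : colored_bigraph t t)
    (v : {set 'I_t * 'I_t} -> A) p q :
  spectrum G p = spectrum G q ->
  matching_monomial G v p = matching_monomial G v q.
Proof.
have monE r : matching_monomial G v r
            = \prod_(c <- [seq edge_color G e | e <- enum r]) v c.
  by rewrite big_map big_enum.
by move=> /eq_seq_msetP eq_pq; rewrite !monE; apply: perm_big.
Qed.

(** Permutations that leave the edge set contribute 0 to the Leibniz formula; the
others are the perfect matchings. Within a class all matchings have the
same monomial, so their signs add up to the signature. *)
Lemma det_color_matrix (A : comNzRingType) t (G : colored_bigraph t t)
    (v : {set 'I_t * 'I_t} -> A) :
  \det (color_matrix G v) = \sum_(P in matching_classes G)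
    (signature P)%:~R * matching_monomial G v (class_rep P).
Proof.
transitivity (\sum_(p in [set p | perfect_matching G p])
    (matching_sign p)%:~R * matching_monomial G v p).
  have -> : [set p | perfect_matching G p]
    = (@perm_matching t) @: [set g | perfect_matching G (perm_matching g)].
    apply/setP => p; rewrite inE; apply/idP/imsetP => [pG | [g + ->]].
      by have [g pE] := perfect_matching_perm pG; exists g; rewrite // inE -pE.
    by rewrite inE.
  rewrite big_imset /=; last by move=> g h _ _; apply: perm_matching_inj.
  rewrite -det_tr /determinant [RHS]big_mkcond; apply: eq_bigr => g _.
  rewrite inE perfect_matching_permE matching_sign_perm rmorphXn rmorphN1.
  case: ifPn => [/forallP gG | /forallPn[i gNi]].
    rewrite /matching_monomial big_imset /=; last by move=> i j _ _ [].
    by congr *%R; apply: eq_bigr => i _; rewrite !mxE gG.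
  by rewrite (bigD1 i) //= !mxE (negPf gNi) mul0r mulr0.
rewrite (set_partition_big _ (matching_classes_partition t G)) /=.
apply: eq_bigr => P PG; rewrite rmorph_sum mulr_suml; apply: eq_bigr => p pP.
congr *%R; apply: monomial_spectrum; apply/eqP.
by rewrite -(class_spectrum _ _ _ _ _ _ PG PG pP (class_rep_mem _ _ _ PG)).
Qed.

(** * Two classes of nonzero signature *)

(** A perfect matching has [t] edges, so each color occurs at most [t] times in
it and base [t.+1] separates the spectra. *)
Lemma kronecker_monomial_inj t (G : colored_bigraph t t) p q :
  perfect_matching G p -> perfect_matching G q ->
  (\sum_(e in p) kronecker_weight t (edge_color G e)
   = \sum_(e in q) kronecker_weight t (edge_color G e))%N ->
  spectrum G p = spectrum G q.
Proof.
have size_t r : perfect_matching G r ->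
  (size [seq edge_color G e | e <- enum r] <= t)%N.
  by case/and3P => _ /eqP card_r _; rewrite size_map -cardE card_r.
move=> /size_t szp /size_t szq eq_pq; apply/eq_seq_msetP.
by apply: kronecker_weight_inj szp szq _; rewrite !big_map !big_enum.
Qed.

(** After the Kronecker substitution, the determinant has the signatures of [P]
and [Q] as two of its coefficients, so it vanishes at some nonzero [z]. *)
Lemma two_classes_singular (R : realType) t (G : colored_bigraph t t) P Q :
  P \in matching_classes G -> Q \in matching_classes G -> P != Q ->
  signature P != 0 -> signature Q != 0 ->
  exists2 M : 'M[R[i]]_t, pattern_class G M & \det M = 0.
Proof.
move=> PG QG neqPQ sgP sgQ.
pose w (c : {set 'I_t * 'I_t}) := kronecker_weight t c.
pose wt (p : {set 'I_t * 'I_t}) := (\sum_(e in p) w (edge_color G e))%N.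
pose f : {poly R[i]} := \det (color_matrix G (fun c => 'X^(w c))).
have wt_inj S T : S \in matching_classes G -> T \in matching_classes G ->
    wt (class_rep S) = wt (class_rep T) -> S = T.
  move=> SG TG eq_wt; have repS := class_rep_mem _ _ _ SG.
  have repT := class_rep_mem _ _ _ TG.
  apply/eqP; rewrite (class_spectrum _ _ _ _ _ _ SG TG repS repT); apply/eqP.
  apply: kronecker_monomial_inj eq_wt; first exact: class_matching SG repS.
  exact: class_matching TG repT.
have monE p : matching_monomial G (fun c => 'X^(w c) : {poly R[i]}) p = 'X^(wt p).
  by rewrite /matching_monomial -prodrXr.
have coef_class S : S \in matching_classes G ->
    f`_(wt (class_rep S)) = (signature S)%:~R.
  move=> SG; rewrite /f det_color_matrix coef_sum (bigD1 S) //=.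
  rewrite big1 => [|T /andP[TG neqTS]]; rewrite monE mulrzl coefMrz coefXn.
    by rewrite eqxx addr0.
  case: eqP => [/(wt_inj _ _ SG TG) eqST | _]; last by rewrite mul0rz.
  by rewrite eqST eqxx in neqTS.
have [||| z z_neq0 fz] :=
  closed_nonzero_root f (wt (class_rep P)) (wt (class_rep Q)).
- by apply: contra neqPQ => /eqP /(wt_inj _ _ PG QG) ->.
- by rewrite coef_class // intr_eq0.
- by rewrite coef_class // intr_eq0.
exists (color_matrix G (fun c => z ^+ w c)).
  by apply/pattern_classP; exists (fun c => z ^+ w c) => // c; apply: expf_neq0.
have <- : horner_eval z f = 0 by exact/rootP.
rewrite /f -det_map_mx; congr (\det _).
apply/matrixP => j i; rewrite !mxE.
by case: ifP => _; rewrite /= /horner_eval ?hornerXn ?horner0.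
Qed.

(** * The criterion *)

Theorem theorem8 (R : realType) (t : nat) (G : colored_bigraph t t) :
  (forall M : 'M[R[i]]_t, pattern_class G M -> M \in unitmx) <->
  (exists p : {set 'I_t * 'I_t}, perfect_matching G p) /\
  (exists! P : {set {set 'I_t * 'I_t}},
     P \in matching_classes G /\ signature P <> 0).
Proof.
split=> [nonsing | [_ [P [[PG /eqP sgP] uniqP]]] M /pattern_classP[v v_neq0 ->]].
  have no_sing (M : 'M[R[i]]_t) : pattern_class G M -> \det M <> 0.
    by move=> /nonsing; rewrite unitmxE unitfE => /eqP.
  have [P PG sgP] : exists2 P, P \in matching_classes G & signature P != 0.
    apply/exists_inP; apply: contra_notT (no_sing (color_matrix G (fun=> 1)) _).
      move=> /exists_inPn sg0; rewrite det_color_matrix big1 // => P PG.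
      by have /negPn/eqP -> := sg0 P PG; rewrite mul0r.
    by apply/pattern_classP; exists (fun=> 1) => // c; apply: oner_neq0.
  split.
    by exists (class_rep P); apply: class_matching (class_rep_mem _ _ _ PG).
  exists P; split=> [|Q [QG /eqP sgQ]]; first by split=> //; apply/eqP.
  apply/eqP; apply: contraT => neqPQ.
  have [M MG detM0] := two_classes_singular R t G P Q PG QG neqPQ sgP sgQ.
  by case: (no_sing M MG).
rewrite unitmxE unitfE det_color_matrix (bigD1 P) //= big1 ?addr0.
  rewrite mulf_neq0 ?intr_eq0 //; apply/prodf_neq0 => e _; exact: v_neq0.
move=> Q /andP[QG neqQP]; have [->|/eqP sgQ] := eqVneq (signature Q) 0.
  by rewrite mul0r.
by rewrite (uniqP Q) ?eqxx // in neqQP.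
Qed.
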